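(* Fix an integer $d\geq 2$. Let $T_d$ be a $d$-tournament on $n$ vertices. Then the number of directed $d$-simplices in $T_d$ is at most $$\frac{1}{d+1}\binom{n}{d+1}+O(n^d)\quad\text{if } d \text{ is odd},$$ and at most $$\frac{1}{d+2}\binom{n}{d+1}+O(n^d)\quad\text{if } d \text{ is even},$$ where the implied constants depend only on $d$. In particular, $c_d\leq \frac{1}{d+1}$ if $d$ is odd, and $c_d\leq\frac{1}{d+2}$ if $d$ is even.
   Context: Orientations of finite sets are defined inductively. An orientation of a 1-set $\{x\}$ is an assignment of $+1$ or $-1$ to $x$. An orientation of a 2-set $\{a,b\}$ is a directed edge from $a$ to $b$ or from $b$ to $a$; a directed edge from $a$ to $b$ is regarded as assigning $+1$ to $b$ and $-1$ to $a$. For $d\ge 3$, an orientation of a $d$-set consists of an orientation of each of its $(d-1)$-subsets such that these are pairwise compatible. Here, for $k\ge 2$, two oriented $k$-sets sharing a common $(k-1)$-subset are compatible if they give different orientations to that common $(k-1)$-subset. For $d\ge 2$, a $d$-tournament (tournament of order $d$) on $n$ vertices is a set of $n$ vertices together with an orientation of each of its $d$-subsets. A $d$-simplex in a $d$-tournament is a $(d+1)$-subset of the vertex set; it is directed if its $d+1$ oriented $d$-subsets are pairwise compatible. The constant $c_d$ is defined as $\lim_{n\to\infty} M_d(n)/\binom{n}{d+1}$, where $M_d(n)$ is the greatest number of directed $d$-simplices in a $d$-tournament on $n$ vertices (the limit exists by an averaging argument). *)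

(* Defs.v *)
From HB Require Import structures.
From mathcomp Require Import all_boot all_order all_algebra.
From mathcomp Require Import all_classical all_reals all_analysis.

Set Implicit Arguments.
Unset Strict Implicit.
Unset Printing Implicit Defensive.

Import Order.TTheory GRing.Theory Num.Theory.
Import numFieldNormedType.Exports.

Local Open Scope ring_scope.

Section Orientations.

Variable V : finType.
Implicit Types A B C D : {set V}.

Definition facet A B : bool := (B \subset A) && (#|B|.+1 == #|A|)%N.

(* One stage of the inductive definition of orientations: the types [ori A] of
   orientations of the k-sets A, the types [ori_face D] of orientations of the
   (k-1)-sets D, and the orientation of D given by an oriented k-set A of which
   D is a (k-1)-subset.  The types are only meaningful on sets of the right
   cardinality. *)
Record stage := Stage {
  ori_face : {set V} -> finType;
  ori : {set V} -> finType;
  face : forall A D, facet A D -> ori A -> ori_face D }.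

(* For distinct B and C of the same cardinality there is at most one common
   facet D; the notion is only used when there is one. *)
Definition compatible (s : stage) B C (oB : ori s B) (oC : ori s C) : bool :=
  [forall D : {D : {set V} | facet B D && facet C D},
     face (proj1 (andP (valP D))) oB != face (proj2 (andP (valP D))) oC].

Definition pairwise_compatible (s : stage) A
    (o : {dffun forall B : {B : {set V} | facet A B}, ori s (val B)}) : bool :=
  [forall B, forall C, (B != C) ==> compatible (o B) (o C)].

Definition next_ori (s : stage) A : finType :=
  {o : {dffun forall B : {B : {set V} | facet A B}, ori s (val B)}
     | pairwise_compatible o}.

Definition next_face (s : stage) A B (AB : facet A B) (o : next_ori s A) :
    ori s B :=
  val o (exist _ B AB).

Definition next_stage (s : stage) : stage := Stage (@next_face s).

(* Signs are booleans, [true] being +1.  A 1-set is considered to give its sign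
   to its only facet, the empty set, so that two oriented 1-sets are compatible
   when their signs differ: an orientation of {a, b} then assigns +1 to one of
   a, b and -1 to the other, i.e., it is a directed edge. *)
Definition first_stage : stage :=
  @Stage (fun=> bool) (fun=> bool) (fun _ _ _ sign => sign).

(* [stage_of d] describes the orientations of d-sets, for d >= 1. *)
Definition stage_of (d : nat) : stage := iter d.-1 next_stage first_stage.

Definition orientation (d : nat) A : finType := ori (stage_of d) A.

Definition tournament (d : nat) : finType :=
  {dffun forall A : {A : {set V} | #|A| == d}, orientation d (val A)}.

Definition directed (d : nat) (T : tournament d) (S : {set V}) : bool :=
  [forall B : {B : {set V} | #|B| == d}, forall C : {C : {set V} | #|C| == d},
     [&& val B \subset S, val C \subset S & B != C] ==>
       compatible (T B) (T C)].

Definition num_directed (d : nat) (T : tournament d) : nat :=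
  #|[set S : {set V} | (#|S| == d.+1) && directed T S]|.

End Orientations.

Definition max_directed (d n : nat) : nat :=
  (\max_(T : tournament 'I_n d) num_directed T)%N.

Definition directed_density (R : realType) (d n : nat) : R :=
  (max_directed d n)%:R / 'C(n, d.+1)%:R.

Definition c_ (R : realType) (d : nat) : R := limn (directed_density R d).

(* Main.v *)
Require Import Defs.
From HB Require Import structures.
From mathcomp Require Import all_boot all_order all_algebra.
From mathcomp Require Import all_classical all_reals all_analysis.
From mathcomp Require Import zify.
(* Gives the names shared with sets over arbitrary types back to finite sets. *)
From mathcomp Require Import fintype finset.

Set Implicit Arguments.
Unset Strict Implicit.
Unset Printing Implicit Defensive.

Import Order.TTheory GRing.Theory Num.Theory.
Import numFieldNormedType.Exports.

Local Open Scope ring_scope.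

(** Call two distinct d-sets adjacent when they share d-1 vertices, equivalently when
    they lie in a common (d+1)-set, and count the ordered pairs of adjacent
    d-sets whose orientations are incompatible in two ways, where n = #|V|.

    By intersection: a (d-1)-set D has only two orientations, so the
    m = n-d+1 d-sets above D fall into two classes according to the orientation
    that they induce on D, and incompatible means in the same class. At most
    m^2/2 of the m(m-1) ordered pairs above D are therefore compatible, and
    asymptotically at least half of all adjacent pairs are incompatible
    ([incompatible_above]).

    By union: the d+1 facets of a (d+1)-set S also fall into two classes, such
    that now compatible means in the same class. With class sizes p and q there
    are 2pq incompatible pairs, so at most ((d+1)^2 - e)/2 of them, where e is 0
    or 1 according to the parity of d+1, and none if S is directed
    ([incompatible_below]). That there are two such classes comes from the
    relation boundary-of-boundary = 0: among three facets of S the number of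
    incompatible pairs is even ([compatible_triangle]).

    Comparing the two counts, at least d(d+1)/((d+1)^2 - e) of the (d+1)-sets are
    not directed, up to O(n^d) ([num_directed_bound]). This proportion is
    d/(d+1) for d odd and (d+1)/(d+2) for d even.

    The density converges because it is eventually nonincreasing: a
    (d+1)-subset of n+1 vertices survives in n-d of the n+1 subtournaments got by
    deleting one vertex ([max_directed_succ]). As tournaments on different vertex
    sets have orientations in different types, deleting a vertex requires
    transporting orientations along an injection ([tournament_restriction]). *)

(** * Orientations come in opposite pairs *)

(** At most two elements, in the form in which it is used: differing twice is
    coming back. *)
Definition two_valued (X : eqType) : Prop :=
  forall x y z : X, x != y -> y != z -> x = z.

(** Comparing with any fixed element [a] is a faithful boolean encoding of a
    two-valued type, which turns arguments about differing into parity. *)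
Lemma two_valued_neq (X : eqType) (a x y : X) :
  two_valued X -> (x != y) = ((x == a) != (y == a)).
Proof.
move=> X2; have [->|xa] := eqVneq x a; first by rewrite eq_sym; case: (y == a).
have [->|ya] := eqVneq y a; first by rewrite xa.
by rewrite (X2 x a y xa) ?eqxx // eq_sym.
Qed.

Section TwoOrientations.

Variable V : finType.
Implicit Types A B C D S : {set V}.

Lemma facetP A B : reflect (exists2 x, x \in A & B = A :\ x) (facet A B).
Proof.
apply: (iffP andP) => [[sBA /eqP cBA]|[x xA ->]]; last first.
  by rewrite subD1set [#|A|](cardsD1 x) xA.
have /cards1P[x Dx] : #|A :\: B| == 1%N by rewrite cardsDS // -cBA subSnn.
have : x \in A :\: B by rewrite Dx set11.
rewrite inE => /andP[_ xA]; exists x => //.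
by rewrite -Dx setDDr setDv set0U; apply/esym/setIidPr.
Qed.

Lemma facet_card A B : facet A B -> #|A| = #|B|.+1.
Proof. by case/andP=> _ /eqP. Qed.

Lemma common_facetE B C D : B != C -> facet B D -> facet C D -> B :&: C = D.
Proof.
move=> BC BD CD.
have cBC : #|C| = #|B| by rewrite (facet_card BD) (facet_card CD).
have [/andP[DB /eqP cB] /andP[DC _]] := (BD, CD).
apply/esym/eqP; rewrite eqEcard subsetI DB DC /= -ltnS cB; apply: proper_card.
rewrite properEneq subsetIl andbT; apply: contraNneq BC => /setIidPl sBC.
by rewrite eqEcard sBC cBC /=.
Qed.

Lemma common_superfacetE S B C :
  B != C -> facet S B -> facet S C -> B :|: C = S.
Proof.
move=> BC SB SC.
have cBC : #|B| = #|C| by have := facet_card SB; rewrite (facet_card SC) => -[].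
have [/andP[BS /eqP cS] /andP[CS _]] := (SB, SC).
apply/eqP; rewrite eqEcard subUset BS CS /= -cS; apply: proper_card.
rewrite properEneq subsetUl andbT; apply: contraNneq BC => /esym/setUidPl sCB.
by rewrite eq_sym eqEcard sCB cBC /=.
Qed.

(** A facet of a set is missing one point; two of them meet in the set missing
    both points. *)
Lemma facetI A B C : facet A B -> facet A C -> B != C ->
  facet B (B :&: C) /\ facet C (B :&: C).
Proof.
case/facetP=> b bA -> /facetP[c cA ->] ne.
have bc : b != c by apply: contraNneq ne => ->.
have -> : (A :\ b) :&: (A :\ c) = A :\ b :\ c.
  by apply/setP=> z; rewrite !inE;
    case: (z == b); case: (z == c); case: (z \in A).
split; apply/facetP; first by exists c; rewrite // !inE eq_sym bc cA.
by exists b; rewrite ?inE ?bc ?bA // setDDl setUC -setDDl.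
Qed.

(** Distinct [B] and [C] have at most one common facet, so the quantifier in
    compatibility is a single test. *)
Lemma compatibleE (s : stage V) B C D (oB : ori s B) (oC : ori s C)
    (BD : facet B D) (CD : facet C D) : B != C ->
  compatible oB oC = (face BD oB != face CD oC).
Proof.
move=> BC; apply/forallP/idP => [H|ne [D' /= BCD']].
  have BCD : facet B D && facet C D by rewrite BD.
  have := H (exist _ D BCD); rewrite /=.
  by rewrite (bool_irrelevance (proj1 _) BD) (bool_irrelevance (proj2 _) CD).
have /andP[BD' CD'] := BCD'.
have eD : D' = D.
  by rewrite -(common_facetE BC BD' CD') (common_facetE BC BD CD).
subst D'.
by rewrite (bool_irrelevance (proj1 _) BD) (bool_irrelevance (proj2 _) CD).
Qed.

Lemma compatible_sym (s : stage V) B C (oB : ori s B) (oC : ori s C) :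
  compatible oB oC = compatible oC oB.
Proof.
have sub B' C' (oB' : ori s B') (oC' : ori s C') :
    compatible oB' oC' -> compatible oC' oB'.
  move/forallP=> H; apply/forallP=> -[D CBD].
  have [CD BD] := andP CBD.
  have BCD : facet B' D && facet C' D by rewrite BD.
  rewrite /= (bool_irrelevance (proj1 _) CD) (bool_irrelevance (proj2 _) BD).
  have := H (exist _ D BCD); rewrite /= eq_sym.
  by rewrite (bool_irrelevance (proj1 _) BD) (bool_irrelevance (proj2 _) CD).
by apply/idP/idP; exact: sub.
Qed.

(** What all stages have in common: an orientation and its opposite are the only
    ones, and they induce opposite orientations on each facet. *)
Definition binary (s : stage V) : Prop :=
  [/\ forall D, two_valued (ori_face s D),
      forall A, two_valued (ori s A)
    & forall A D (AD : facet A D), injective (@face V s A D AD)].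

Lemma next_oriE (s : stage V) A (o : ori (next_stage s) A) B C
    (AB : facet A B) (AC : facet A C) : B != C ->
  compatible (@face V (next_stage s) A B AB o)
             (@face V (next_stage s) A C AC o).
Proof.
move=> BC; have /forallP /(_ (exist _ B AB)) := valP o.
by move=> /forallP /(_ (exist _ C AC)) /implyP; apply; rewrite -val_eqE.
Qed.

(** An orientation of [A] is determined by its value on one facet [D]: any other
    facet must differ from [D] on the common facet, where only two orientations
    are possible. *)
Lemma binary_next (s : stage V) : binary s -> binary (next_stage s).
Proof.
move=> [face2 ori2 face_inj].
have next_inj A D (AD : facet A D) :
    injective (@face V (next_stage s) A D AD).
  move=> o o' eoo'; apply/val_inj/ffunP => -[B AB].
  have [eBD|DB] := eqVneq D B.
    by subst B; rewrite (bool_irrelevance AB AD); exact: eoo'.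
  have [DX BX] := facetI AD AB DB.
  have := next_oriE o AD AB DB; have := next_oriE o' AD AB DB.
  rewrite -eoo' !(compatibleE _ _ DX BX) // => ne' ne.
  by apply: (face_inj _ _ BX); apply: face2 ne'; rewrite eq_sym.
split=> // A x y z xy yz.
have [A0|[a aA]] := set_0Vmem A.
  by apply/val_inj/ffunP => -[B AB]; exfalso; have := facet_card AB;
    rewrite A0 cards0.
have AD : facet A (A :\ a) by apply/facetP; exists a.
by apply: (next_inj _ _ AD); apply: (ori2 _ _ (face AD y));
  rewrite (inj_eq (@next_inj _ _ AD)).
Qed.

Lemma binary_stage d : binary (stage_of V d).
Proof.
rewrite /stage_of; elim: d.-1 => [|k IHk]; last exact: binary_next.
by split=> [D|A|A D AD x y] //= [] [] [].
Qed.

(** The number of incompatible pairs among three facets [B], [C], [E] of a set is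
    even. On [X], the intersection of the three, consider the six orientations
    induced by going from one of [B], [C], [E] through one of its two
    intersections with the others. Within each of [B], [C], [E] the two ways to
    [X] differ, by compatibility of the faces of an oriented set; across each
    intersection they differ or agree as the pair is compatible or not. Going
    round this hexagon meets an even number of changes: three, plus one for each
    compatible pair. *)
Lemma compatible_triangle (s : stage V) S B C E
    (oB : ori (next_stage s) B) (oC : ori (next_stage s) C)
    (oE : ori (next_stage s) E) : binary s ->
  facet S B -> facet S C -> facet S E -> B != C -> B != E -> C != E ->
  compatible oB oC = compatible oB oE -> compatible oC oE.
Proof.
move=> [face2 ori2 face_inj] SB SC SE BC BE CE.
have [B_BC C_BC] := facetI SB SC BC.
have [B_BE E_BE] := facetI SB SE BE.
have [C_CE E_CE] := facetI SC SE CE.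
have neq_meet : B :&: C != B :&: E /\ B :&: C != C :&: E /\ B :&: E != C :&: E.
  case/facetP: SB BC BE {B_BC C_BC B_BE E_BE C_CE E_CE oB} => b bS ->.
  case/facetP: SC CE {oC} => c cS ->; case/facetP: SE {oE} => e eS ->.
  move=> ce bc be.
  have {}bc : b != c by apply: contraNneq bc => ->.
  have {}be : b != e by apply: contraNneq be => ->.
  have {}ce : c != e by apply: contraNneq ce => ->.
  split; [|split]; apply/eqP => /setP.
  - by move/(_ c); rewrite !inE eqxx (eq_sym c b) bc ce cS.
  - by move/(_ b); rewrite !inE eqxx bc be bS.
  - by move/(_ b); rewrite !inE eqxx bc be bS.
case: neq_meet => nBCBE [nBCCE nBECE].
pose X := B :&: C :&: E.
have XB : (B :&: C) :&: (B :&: E) = X by rewrite /X setIACA setIid setIA.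
have XC : (B :&: C) :&: (C :&: E) = X 
  by rewrite /X setIA -(setIA B) setIid.
have XE : (B :&: E) :&: (C :&: E) = X by rewrite setIACA setIid.
have [] := facetI B_BC B_BE nBCBE; rewrite XB => BC_X BE_X.
have [_] := facetI C_BC C_CE nBCCE; rewrite XC => CE_X.
have := next_oriE oB B_BC B_BE nBCBE.
have := next_oriE oC C_BC C_CE nBCCE.
have := next_oriE oE E_BE E_CE nBECE.
rewrite (compatibleE _ _ BE_X CE_X nBECE) (compatibleE _ _ BC_X CE_X nBCCE).
rewrite (compatibleE _ _ BC_X BE_X nBCBE).
rewrite (compatibleE _ _ B_BC C_BC BC) (compatibleE _ _ B_BE E_BE BE).
rewrite (compatibleE _ _ C_CE E_CE CE).
rewrite -(inj_eq (face_inj _ _ BC_X)) -(inj_eq (face_inj _ _ BE_X)).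
rewrite -(inj_eq (face_inj _ _ CE_X)).
move: (face BE_X (face E_BE oE)) => x1.
rewrite !(two_valued_neq x1 _ _ (face2 X)).
by do 6!case: (_ == x1).
Qed.

End TwoOrientations.

(** * Counting incompatible pairs *)

Definition off_diag (I : finType) (X : {set I}) : {set I * I} :=
  [set e | [&& e.1 \in X, e.2 \in X & e.1 != e.2]].

Lemma card_off_diag (I : finType) (X : {set I}) :
  #|off_diag X| = (#|X| * #|X|.-1)%N.
Proof.
have -> : off_diag X = setX X X :\: [set (x, x) | x in X].
  apply/setP=> -[x y]; rewrite !inE /=.
  have [->|xy] := eqVneq x y; last first.
    rewrite andbT; case: imsetP => //= -[z _ [xz yz]].
    by rewrite xz yz eqxx in xy.
  case: imsetP => [_|nX]; first by rewrite !andbF.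
  by rewrite !andbF; case yX: (y \in X) => //; case: nX; exists y.
rewrite cardsDS; last by apply/subsetP=> _ /imsetP[x xX ->]; rewrite inE xX.
by rewrite cardsX card_imset => [|x y []//]; case: #|X| => // k /=; lia.
Qed.

(** The hypothesis says that [r] is the relation of being in different classes of
    a partition of [X] in two classes: fix [x0] and colour each [y] by
    [r x0 y]. *)
Lemma bipartite_off_diag (I : finType) (r : rel I) (X : {set I}) :
  symmetric r ->
  {in X & &, forall x y z, x != y -> x != z -> y != z ->
     r x y = r x z -> ~~ r y z} ->
  exists p q, (p + q = #|X|)%N /\
    (#|off_diag X :&: [set e | r e.1 e.2]| <= 2 * (p * q))%N.
Proof.
move=> rC rX; have [->|[x0 x0X]] := set_0Vmem X.
  exists 0%N, 0%N; rewrite cards0; split=> //; rewrite leqn0 cards_eq0.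
  by apply/eqP/setP=> e; rewrite !inE.
pose c x := (x != x0) && r x0 x.
pose X1 := [set x in X | c x]; pose X0 := [set x in X | ~~ c x].
exists #|X1|, #|X0|; split.
  rewrite -(cardsID [set x | c x] X) -setIdE; congr (_ + #|pred_of_set _|)%N.
  by apply/setP=> x; rewrite !inE andbC.
apply: (@leq_trans #|setX X1 X0 :|: setX X0 X1|); last first.
  by rewrite (leq_trans (leq_card_setU _ _)) // !cardsX mulnC mul2n -addnn.
apply/subset_leq_card/subsetP=> -[x y]; rewrite !inE /=.
case/andP=> /and3P[xX yX xy] rxy; rewrite xX yX /=.
suff : c x != c y by case: (c x); case: (c y).
rewrite /c; have [ex|xx0] := eqVneq x x0.
  by rewrite -ex (eq_sym y) xy rxy.
have [ey|yx0] := eqVneq y x0; first by rewrite -ey rC rxy.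
apply: contraTN rxy => /eqP.
by apply: rX; rewrite // eq_sym.
Qed.

(** Equality in the arithmetic-geometric inequality needs p = q, hence m even. *)
Lemma four_mul_leq p q m : (p + q)%N = m -> (4 * (p * q) <= m ^ 2 - odd m)%N.
Proof.
move=> <-; have [le4 eq4] := nat_AGM2 p q.
case o: (odd (p + q)); last by rewrite subn0.
suff : (4 * (p * q) < (p + q) ^ 2)%N by lia.
rewrite ltn_neqAle le4 eq4 andbT.
by apply: contraTneq o => ->; rewrite addnn odd_double.
Qed.

Section Counting.

Variables (V : finType) (d : nat).
Hypothesis d_gt0 : (0 < d)%N.

Local Notation dset := {B : {set V} | #|B| == d}.
Implicit Types (D S : {set V}) (B C : dset).

Definition dsets_above D : {set dset} := [set B : dset | D \subset val B].
Definition dsets_below S : {set dset} := [set B : dset | val B \subset S].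

Lemma card_dsets (P : pred {set V}) :
  #|[set B : dset | P (val B)]| = #|[set B : {set V} | P B & #|B| == d]|.
Proof.
rewrite -(card_imset _ val_inj); apply: eq_card => B; rewrite [RHS]inE.
apply/imsetP/andP => [[B' + ->]|[PB cB]].
  by rewrite inE => PB'; split=> //; exact: (valP B').
by exists (exist _ B cB); rewrite ?inE.
Qed.

Lemma card_dsets_below S : #|S| = d.+1 -> #|dsets_below S| = d.+1.
Proof.
by move=> cS; rewrite (card_dsets (fun A => A \subset S)) cards_draws cS binSn.
Qed.

Lemma card_dsets_above D : #|D| = d.-1 -> #|dsets_above D| = (#|V| - d.-1)%N.
Proof.
move=> cD; rewrite (card_dsets (fun A => D \subset A)) -cD -(cardsC D) addKn.
have -> : [set B : {set V} | (D \subset B) & (#|B| == d)] =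
          (fun x => x |: D) @: (~: D).
  apply/setP=> B; rewrite inE; apply/andP/imsetP => [[DB /eqP cB]|[x]].
    have /facetP[x xB eD] : facet B D by rewrite /facet DB cD cB prednK /=.
    by exists x; rewrite ?eD ?setD1K // !inE eqxx.
  by rewrite inE => xD ->; rewrite subsetUr cardsU1 xD cD add1n prednK /=.
rewrite card_in_imset // => x y; rewrite !inE => xD yD /setP/(_ x).
by rewrite !inE eqxx (negbTE xD) !orbF => /esym/eqP.
Qed.

(** The double counting: distinct d-sets meet in a (d-1)-set iff their union is a
    (d+1)-set, so both sides count the adjacent pairs in [P], sorted by
    intersection on the left and by union on the right. *)
Lemma exchange_off_diag (P : {set dset * dset}) :
  (\sum_(D : {set V} | #|D| == d.-1) #|off_diag (dsets_above D) :&: P| =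
   \sum_(S : {set V} | #|S| == d.+1) #|off_diag (dsets_below S) :&: P|)%N.
Proof.
pose adj := [set e : dset * dset | (#|val e.1 :&: val e.2| == d.-1) && (e \in P)].
have cU (e : dset * dset) :
    (#|val e.1 :|: val e.2| == d.+1) = (#|val e.1 :&: val e.2| == d.-1).
  have := cardsUI (val e.1) (val e.2).
  by rewrite (eqP (valP e.1)) (eqP (valP e.2)); lia.
transitivity #|adj|.
  rewrite -sum1_card (partition_big (fun e : dset * dset => val e.1 :&: val e.2)
    (fun D => #|D| == d.-1)) /=; last by move=> e; rewrite inE => /andP[].
  apply: eq_bigr => D /eqP cD; rewrite -sum1_card; apply: eq_bigl => -[B C].
  rewrite !inE /= [RHS]andbAC; congr (_ && _).
  apply/and3P/andP => [[DB DC BC]|[/eqP cBC /eqP <-]]; last first.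
    split; rewrite ?subsetIl ?subsetIr //; apply: contra_eqN cBC => /eqP ->.
    by rewrite setIid (eqP (valP C)); lia.
  have fD (E : dset) : D \subset val E -> facet (val E) D.
    by move=> DE; rewrite /facet DE cD (eqP (valP E)) prednK /=.
  by rewrite (common_facetE _ (fD B _) (fD C _)) // cD.
rewrite -sum1_card (partition_big (fun e : dset * dset => val e.1 :|: val e.2)
  (fun S => #|S| == d.+1)) /=; last by move=> e; rewrite inE cU => /andP[].
apply: eq_bigr => S /eqP cS; rewrite -sum1_card; apply: eq_bigl => -[B C].
rewrite !inE -cU /= [LHS]andbAC; congr (_ && _).
apply/andP/and3P => [[/eqP cBC /eqP <-]|[BS CS BC]].
  split; rewrite ?subsetUl ?subsetUr //; apply: contra_eqN cBC => /eqP ->.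
  by rewrite setUid (eqP (valP C)); lia.
have fS (E : dset) : val E \subset S -> facet S (val E).
  by move=> ES; rewrite /facet ES cS (eqP (valP E)) /=.
by rewrite (common_superfacetE _ (fS B _) (fS C _)) // cS.
Qed.

End Counting.

Section Bound.

Variables (V : finType) (k : nat).
Let d := k.+2.
Variable T : tournament V d.

Local Notation dset := {B : {set V} | #|B| == d}.

Definition incompatible : {set dset * dset} :=
  [set e | ~~ compatible (T e.1) (T e.2)].

(** Compatibility is being in different classes here, so with m d-sets above [D]
    there are at most m^2/2 compatible pairs, and m(m-1) - m^2/2 is
    (m(m-1) - m)/2. *)
Lemma incompatible_above (D : {set V}) : #|D| = k.+1 ->
  (#|dsets_above d D| * #|dsets_above d D|.-1 <=
   #|dsets_above d D| + 2 * #|off_diag (dsets_above d D) :&: incompatible|)%N.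
Proof.
move=> cD; set X := dsets_above d D.
have fD B : B \in X -> facet (val B) D.
  by rewrite inE => DB; rewrite /facet DB cD (eqP (valP B)) /=.
have [||p [q [cX le_pq]]] :=
    @bipartite_off_diag _ (fun B C : dset => compatible (T B) (T C)) X.
- by move=> B C; exact: compatible_sym.
- move=> B C E BX CX EX BC BE CE.
  rewrite (compatibleE _ _ (fD _ BX) (fD _ CX) BC).
  rewrite (compatibleE _ _ (fD _ BX) (fD _ EX) BE).
  rewrite (compatibleE _ _ (fD _ CX) (fD _ EX) CE).
  have [face2 _ _] := binary_stage V d.
  rewrite !(two_valued_neq (face (fD _ BX) (T B)) _ _ (face2 D)) eqxx.
  by do 2!case: (_ == face _ _).
have := cardsID [set e | compatible (T e.1) (T e.2)] (off_diag X).
have -> : off_diag X :\: [set e | compatible (T e.1) (T e.2)] =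
          off_diag X :&: incompatible.
  by apply/setP=> e; rewrite !inE andbC.
rewrite card_off_diag; have := four_mul_leq cX.
move: le_pq; rewrite -mulnn; move: (p * q)%N (odd _ : nat) => pq o.
move: #|_ :&: incompatible| #|_ :&: _| => b a. case: #|X| => [|m] /=; nia.
Qed.

(** Incompatibility is being in different classes here, by
    [compatible_triangle]. *)
Lemma incompatible_below (S : {set V}) : #|S| = d.+1 ->
  (2 * #|off_diag (dsets_below d S) :&: incompatible| <=
   (d.+1 ^ 2 - odd d.+1) * ~~ directed T S)%N.
Proof.
move=> cS; have [dS|_] := boolP (directed T S).
  rewrite muln0 leqn0 muln_eq0 cards_eq0; apply/eqP/setP=> -[B C].
  rewrite !inE /=; apply/negP=> /andP[/and3P[BS CS BC]].
  by move/forallP: dS => /(_ B)/forallP/(_ C); rewrite BS CS BC /= => ->.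
rewrite muln1; set X := dsets_below d S.
have fS B : B \in X -> facet S (val B).
  by rewrite inE => BS; rewrite /facet BS cS (eqP (valP B)) /=.
have [||p [q [cX le_pq]]] :=
    @bipartite_off_diag _ (fun B C : dset => ~~ compatible (T B) (T C)) X.
- by move=> B C; rewrite compatible_sym.
- move=> B C E BX CX EX BC BE CE /negb_inj eBC; rewrite negbK.
  (* As d is at least 2, an oriented d-set is a compatible family of oriented
     (d-1)-sets. *)
  exact: (@compatible_triangle V (stage_of V k.+1) S _ _ _ (T B) (T C) (T E)
    (binary_stage V _) (fS _ BX) (fS _ CX) (fS _ EX)).
rewrite card_dsets_below // in cX; have := four_mul_leq cX.
by apply: leq_trans; rewrite -[4%N]/(2 * 2)%N -mulnA leq_mul2l.
Qed.

(** Sum [incompatible_above] over the (d-1)-sets and [incompatible_below] over the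
    (d+1)-sets. The main term m(m-1) of the former, summed, is turned into
    d(d+1) times the number of (d+1)-sets, and its error term m into d times
    the number of d-sets. *)
Lemma num_directed_bound :
  (d.+1 * d * 'C(#|V|, d.+1) + (d.+1 ^ 2 - odd d.+1) * num_directed T <=
   d * 'C(#|V|, d) + (d.+1 ^ 2 - odd d.+1) * 'C(#|V|, d.+1))%N.
Proof.
set n := #|V|; set M := (_ - odd _)%N.
have sum_below : (2 * \sum_(S : {set V} | #|S| == d.+1)
      #|off_diag (dsets_below d S) :&: incompatible| + M * num_directed T <=
    M * 'C(n, d.+1))%N.
  have -> : num_directed T = (\sum_(S : {set V} | #|S| == d.+1) directed T S)%N.
    rewrite /num_directed -sum1_card big_mkcond [RHS]big_mkcond.
    by apply: eq_bigr => S _; rewrite inE; case: (_ == _); case: (directed T S).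
  have -> : 'C(n, d.+1) = (\sum_(S : {set V} | #|S| == d.+1) 1)%N.
    by rewrite sum1dep_card card_draws.
  rewrite !big_distrr /= -big_split; apply: leq_sum => S /eqP cS.
  have := incompatible_below cS; rewrite -/M.
  by case: (directed T S) => /=; rewrite ?muln0 ?muln1 ?addn0; lia.
have := @exchange_off_diag V d isT incompatible => exch.
rewrite -exch -[d.-1]/(k.+1) in sum_below.
have sum_above : ('C(n, k.+1) * ((n - k.+1) * (n - k.+1).-1) <=
    'C(n, k.+1) * (n - k.+1) + 2 * \sum_(D : {set V} | #|D| == k.+1)
      #|off_diag (dsets_above d D) :&: incompatible|)%N.
  have -> : 'C(n, k.+1) = (\sum_(D : {set V} | #|D| == k.+1) 1)%N.
    by rewrite sum1dep_card card_draws.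
  rewrite !big_distrl big_distrr /= -big_split; apply: leq_sum => D /eqP cD.
  by have := incompatible_above cD; rewrite card_dsets_above ?mul1n.
have binS m : ((n - m) * 'C(n, m) = m.+1 * 'C(n, m.+1))%N.
  by rewrite mul_bin_left.
have e1 := binS k.+1; have e2 := binS k.+2.
have ed : (n - k.+2 = (n - k.+1).-1)%N by lia.
have e3 : ('C(n, k.+1) * ((n - k.+1) * (n - k.+1).-1) =
           d.+1 * d * 'C(n, d.+1))%N.
  rewrite mulnA (mulnC 'C(n, _)) e1 -mulnA (mulnC 'C(n, _)) -ed e2.
  by rewrite mulnCA mulnA.
have e4 : ('C(n, k.+1) * (n - k.+1) = d * 'C(n, d))%N by rewrite mulnC e1.
rewrite e3 e4 in sum_above.
by rewrite (leq_trans (leq_add sum_above (leqnn _))) // -addnA leq_add2l.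
Qed.

End Bound.

(** * Restricting a tournament to a subset of its vertices *)

Section Restriction.

Variables (V W : finType) (h : V -> W).
Hypothesis h_inj : injective h.

Lemma facet_imset (A D : {set V}) : facet (h @: A) (h @: D) = facet A D.
Proof.
rewrite /facet !card_imset //; congr (_ && _).
apply/subsetP/subsetP => [sDA x xD|sDA _ /imsetP[x xD ->]].
  by rewrite -(mem_imset _ _ h_inj) sDA // imset_f.
by rewrite imset_f // sDA.
Qed.

(** [phi] and [psi] pull orientations of the image of a set back to the set,
    naturally with respect to faces. Injectivity is what preserves
    compatibility, which is an inequality of faces. *)
Definition stage_restriction (sW : stage W) (sV : stage V)
    (phi : forall A : {set V}, ori sW (h @: A) -> ori sV A)
    (psi : forall D : {set V}, ori_face sW (h @: D) -> ori_face sV D) : Prop :=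
  [/\ forall A, injective (phi A), forall D, injective (psi D)
    & forall A D (AD : facet A D) (hAD : facet (h @: A) (h @: D)) o,
        face AD (phi A o) = psi D (face hAD o)].

Lemma compatible_restriction (sW : stage W) (sV : stage V) phi psi :
  @stage_restriction sW sV phi psi ->
  forall (B C : {set V}) (oB : ori sW (h @: B)) (oC : ori sW (h @: C)),
  compatible oB oC -> compatible (phi B oB) (phi C oC).
Proof.
move=> [_ psi_inj faceE] B C oB oC /forallP cBC; apply/forallP => -[D BCD] /=.
have hBCD : facet (h @: B) (h @: D) && facet (h @: C) (h @: D).
  by rewrite !facet_imset.
have [hBD hCD] := andP hBCD.
rewrite (faceE _ _ _ hBD) (faceE _ _ _ hCD) (inj_eq (@psi_inj D)).
have := cBC (exist _ (h @: D) hBCD); rewrite /=.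
by rewrite (bool_irrelevance (proj1 _) hBD) (bool_irrelevance (proj2 _) hCD).
Qed.

(** An orientation being the family of its faces, orientations one stage up are
    pulled back facet by facet. *)
Lemma next_restriction (sW : stage W) (sV : stage V) phi psi :
  @stage_restriction sW sV phi psi ->
  exists phi', @stage_restriction (next_stage sW) (next_stage sV) phi' phi.
Proof.
move=> res; have [phi_inj psi_inj faceE] := res.
have hf (A : {set V}) (B : {B : {set V} | facet A B}) :
    facet (h @: A) (h @: val B) by rewrite facet_imset; exact: valP B.
pose fam (A : {set V}) (o : next_ori sW (h @: A)) :
    {dffun forall B : {B : {set V} | facet A B}, ori sV (val B)} :=
  [ffun B => phi (val B) (next_face (hf A B) o)].
have fam_ok A o : pairwise_compatible (fam A o).
  apply/forallP=> B; apply/forallP=> C; apply/implyP=> BC.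
  rewrite !ffunE; apply: (compatible_restriction res).
  apply: next_oriE; rewrite (inj_eq (imset_inj h_inj)).
  by rewrite (inj_eq val_inj).
exists (fun A o => exist _ (fam A o) (fam_ok A o)); split=> //.
- move=> A o o' /(congr1 val)/ffunP eoo'; apply/val_inj/ffunP => -[B' AB'].
  have [B eB] : exists B : {set V}, B' = h @: B.
    exists (h @^-1: B'); have /andP[/subsetP sB _] := AB'.
    apply/setP=> y; apply/idP/imsetP => [yB|[x]].
      have /imsetP[x _ eyx] := sB y yB.
      by exists x => //; rewrite inE -eyx.
    by rewrite inE => xB ->.
  subst B'; have AB := AB'; rewrite facet_imset in AB.
  have := eoo' (exist _ B AB); rewrite !ffunE => /phi_inj.
  by rewrite /next_face /= (bool_irrelevance (hf A (exist _ B AB)) AB').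
- move=> A B AB hAB o; rewrite /= /next_face /= ffunE /next_face /=.
  by rewrite (bool_irrelevance (hf A (exist _ B AB)) hAB).
Qed.

Lemma stage_of_restriction d :
  exists phi psi, @stage_restriction (stage_of W d) (stage_of V d) phi psi.
Proof.
rewrite /stage_of; elim: d.-1 => [|k [phi [psi /next_restriction[phi' res]]]].
  by exists (fun _ => id), (fun _ => id); split=> [A x y|D x y|].
by exists phi', phi.
Qed.

Lemma tournament_restriction d (T : tournament W d) :
  exists T' : tournament V d,
    forall S : {set V}, directed T (h @: S) -> directed T' S.
Proof.
have [phi [psi res]] := stage_of_restriction d.
have hd (A : {A : {set V} | #|A| == d}) : #|h @: val A| == d.
  by rewrite card_imset //; exact: valP A.
pose hA (A : {A : {set V} | #|A| == d}) : {A : {set W} | #|A| == d} :=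
  exist _ (h @: val A) (hd A).
exists [ffun A => phi (val A) (T (hA A))] => S /forallP dS.
apply/forallP=> B; apply/forallP=> C; apply/implyP=> /and3P[BS CS BC].
rewrite !ffunE; apply: (compatible_restriction res).
have /forallP/(_ (hA C))/implyP := dS (hA B); apply.
rewrite !imsetS //= -val_eqE /= (inj_eq (imset_inj h_inj)).
by rewrite (inj_eq val_inj).
Qed.

End Restriction.

(** * Convergence of the density *)

Lemma num_directed_max d n (T : tournament 'I_n d) :
  (num_directed T <= max_directed d n)%N.
Proof. exact: (leq_bigmax T). Qed.

(** Count the pairs of a directed simplex and a vertex outside it, in a
    tournament on n+1 vertices: each simplex has n-d vertices outside it, and
    those that avoid a vertex live in a tournament on n vertices. *)
Lemma max_directed_succ d n :
  ((n - d) * max_directed d n.+1 <= n.+1 * max_directed d n)%N.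
Proof.
rewrite [X in (_ * X <= _)%N]/max_directed.
elim/big_ind: _ => [|a b le_a le_b|T _]; first by rewrite muln0.
  by rewrite maxnMr geq_max le_a.
pose X := [set S : {set 'I_n.+1} | (#|S| == d.+1) && directed T S].
have -> : ((n - d) * num_directed T =
    \sum_(v < n.+1) #|[set S in X | v \notin S]|)%N.
  transitivity (\sum_(v < n.+1) \sum_(S in X) (v \notin S))%N; last first.
    apply: eq_bigr => v _; rewrite -sum1_card big_mkcond [RHS]big_mkcond.
    by apply: eq_bigr => S _; rewrite [S \in [set _ in _ | _]]inE;
      case: (S \in X); case: (v \in S).
  rewrite exchange_big /= mulnC -sum_nat_const; apply: eq_bigr => S.
  rewrite inE => /andP[/eqP cS _].
  have -> : (n - d = #|~: S|)%N by rewrite -(addKn #|S| #|~: S|) cardsC card_ord cS.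
  rewrite -sum1_card big_mkcond; apply: eq_bigr => v _.
  by rewrite inE; case: (v \in S).
have -> : (n.+1 * max_directed d n = \sum_(v < n.+1) max_directed d n)%N.
  by rewrite sum_nat_const card_ord.
apply: leq_sum => v _.
have [T' dT'] := tournament_restriction (@lift_inj _ v) T.
apply: leq_trans (num_directed_max T').
rewrite /num_directed -[leqRHS](card_imset _ (imset_inj (@lift_inj _ v))).
apply/subset_leq_card/subsetP=> S; rewrite !inE => /andP[/andP[cS dS] vS].
have eS : S = lift v @: (lift v @^-1: S).
  apply/setP=> y; apply/idP/imsetP => [yS|[x]]; last by rewrite inE => xS ->.
  have vy : v != y by apply: contraNneq vS => ->.
  by have [x eyx] := unlift_some vy; exists x => //; rewrite inE -eyx.
apply/imsetP; exists (lift v @^-1: S) => //; rewrite inE dT' -?eS // andbT.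
by rewrite -(card_imset _ (@lift_inj _ v)) -eS.
Qed.

Section Density.

Variables (R : realType) (d : nat).

Lemma directed_density_ge0 n : 0 <= directed_density R d n.
Proof. by rewrite divr_ge0. Qed.

Lemma directed_density_succ n : (d < n)%N ->
  directed_density R d n.+1 <= directed_density R d n.
Proof.
move=> dn; rewrite /directed_density.
have bin_pos m : (n <= m)%N -> 0 < 'C(m, d.+1)%:R :> R.
  by move=> nm; rewrite ltr0n bin_gt0 (leq_trans dn).
rewrite ler_pdivrMr ?bin_pos // mulrAC ler_pdivlMr ?bin_pos //.
rewrite -!natrM ler_nat -(@leq_pmul2l (n - d)) ?subn_gt0 //.
have := mul_bin_down n.+1 d.+1; rewrite /= subSS => eC.
rewrite [leqRHS]mulnCA -eC [leqRHS]mulnCA !mulnA.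
by rewrite leq_mul2r max_directed_succ orbT.
Qed.

Lemma is_cvg_directed_density : cvgn (directed_density R d).
Proof.
apply: (@near_nonincreasing_is_cvgn _ _ 0); last first.
  by apply: nearW; exact: directed_density_ge0.
near=> n => m nm.
have dn : (d < n)%N by near: n; exact: nbhs_infty_gt.
elim: m nm => [|m IHm]; first by rewrite leqn0 => /eqP ->.
rewrite leq_eqVlt => /predU1P[->//|nm].
by apply: le_trans (IHm nm); apply: directed_density_succ; exact: leq_trans dn _.
Unshelve. all: by end_near. Qed.

(** The error term is negligible: 'C(n, d) / 'C(n, d.+1) = (d+1) / (n-d). *)
Lemma directed_density_limit_le (a : R) :
  (forall n (T : tournament 'I_n d),
     (num_directed T)%:R <= a * 'C(n, d.+1)%:R + 'C(n, d)%:R) ->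
  0 <= a -> c_ R d <= a.
Proof.
move=> bound a0.
have max_bound n : (max_directed d n)%:R <= a * 'C(n, d.+1)%:R + 'C(n, d)%:R.
  rewrite /max_directed; elim/big_ind: _ => [|x y le_x le_y|T _] //.
    by rewrite addr_ge0 ?mulr_ge0.
  by rewrite /maxn; case: ifP.
apply/ler_addgt0Pr => e e0; apply: limr_le; first exact: is_cvg_directed_density.
near=> n.
have dn : (d < n)%N by near: n; exact: nbhs_infty_gt.
(* Beyond this rank (d+1) / (n-d) is at most e. *)
have nbig : d%:R + d.+1%:R / e <= n%:R.
  by near: n; exact: nbhs_infty_ger.
have C_gt0 : 0 < 'C(n, d.+1)%:R :> R by rewrite ltr0n bin_gt0.
rewrite /directed_density ler_pdivrMr // (le_trans (max_bound n)) // mulrDl lerD2l.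
rewrite -(@ler_pM2l _ d.+1%:R) // mulrCA -[d.+1%:R * 'C(n, d.+1)%:R]natrM mul_bin_left.
rewrite natrM natrB; last exact: ltnW.
rewrite mulrA ler_wpM2r //.
by rewrite -ler_pdivrMl // lerBrDl mulrC.
Unshelve. all: by end_near. Qed.

End Density.

(** * The bounds *)

Lemma bin_leq_exp n d : ('C(n, d) <= n ^ d)%N.
Proof.
apply: (@leq_trans (n ^_ d)).
  by rewrite -bin_ffact leq_pmulr // fact_gt0.
rewrite ffact_prod -[X in (_ <= _ ^ X)%N](card_ord d) -prod_nat_const.
by apply: leq_prod => i _; exact: leq_subr.
Qed.

Definition density_denominator (d : nat) : nat := if odd d then d.+1 else d.+2.

(** The factor of [num_directed_bound] is (d+1)^2 for d odd and d(d+2) for d even;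
    divide by d+1, respectively by d. *)
Lemma num_directed_le (R : realType) (V : finType) (d : nat)
    (T : tournament V d) : (2 <= d)%N ->
  (num_directed T)%:R <=
    1 / (density_denominator d)%:R * 'C(#|V|, d.+1)%:R + 'C(#|V|, d)%:R :> R.
Proof.
case: d T => [|[|k]] // T _; have := num_directed_bound T.
set d := k.+2; set x := num_directed T; set c := 'C(_, d.+1); set b := 'C(_, d).
move=> bnd.
suff le_nat : (density_denominator d * x <= c + density_denominator d * b)%N.
  have s0 : (0 < density_denominator d)%N by rewrite /density_denominator; case: ifP.
  rewrite -(@ler_pM2l _ (density_denominator d)%:R) ?ltr0n //.
  rewrite mulrDr !mulrA mulr1 mulfV ?pnatr_eq0 ?lt0n_neq0 // mul1r.
  by rewrite -!natrM -natrD ler_nat.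
move: bnd; rewrite /density_denominator oddS; case: (odd d) => /= bnd.
- rewrite subn0 -mulnn -!mulnA -mulnDr in bnd.
  rewrite -(@leq_pmul2l d.+1) //; nia.
- rewrite -(@leq_pmul2l d) //; nia.
Qed.

Theorem theorem3p2 (R : realType) (d : nat) (hd : (2 <= d)%N) :
  [/\ odd d ->
        exists K : R, forall (n : nat) (V : finType) (hn : #|V| = n)
            (T : tournament V d),
          (num_directed T)%:R <=
            1 / d.+1%:R * 'C(n, d.+1)%:R + K * n%:R ^+ d,
      ~~ odd d ->
        exists K : R, forall (n : nat) (V : finType) (hn : #|V| = n)
            (T : tournament V d),
          (num_directed T)%:R <=
            1 / d.+2%:R * 'C(n, d.+1)%:R + K * n%:R ^+ d,
      cvgn (directed_density R d),
      odd d -> c_ R d <= 1 / d.+1%:R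
    & ~~ odd d -> c_ R d <= 1 / d.+2%:R].
Proof.
have bound (V : finType) (T : tournament V d) := num_directed_le R T hd.
have limit : c_ R d <= 1 / (density_denominator d)%:R.
  apply: directed_density_limit_le; last by rewrite divr_ge0.
  by move=> n T; have := bound _ T; rewrite card_ord.
have uniform : exists K : R, forall (n : nat) (V : finType) (hn : #|V| = n)
    (T : tournament V d), (num_directed T)%:R <=
      1 / (density_denominator d)%:R * 'C(n, d.+1)%:R + K * n%:R ^+ d.
  (* A binomial 'C(n, d) of error, without constant, is at most n ^ d. *)
  exists 1 => n V <- T; apply: le_trans (bound V T) _.
  by rewrite lerD2l mul1r -natrX ler_nat bin_leq_exp.
move: limit uniform; rewrite /density_denominator.
by case: (odd d) => limit uniform; split=> //;
  exact: is_cvg_directed_density.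
Qed.
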